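(* Let $\Gamma=A*_\phi$ with $\phi:C_{-1}\to C_{+1}$ be an HNN extension; let $\mathrm{Fix}\,\phi$ be the subgroup of $C_{-1}\cap C_{+1}$ consisting of the fixed points of $\phi$, and $Z(\Gamma)$ the centre of $\Gamma$. (i) If $C_{-1}$ or $C_{+1}$ is a proper subgroup of $A$, then $Z(\Gamma)=Z(A)\cap\mathrm{Fix}\,\phi$. (ii) If $C_{-1}=C_{+1}=A$ and $\phi$ has infinite order in $\mathrm{Out}(A)$, then $Z(\Gamma)=Z(A)\cap\mathrm{Fix}\,\phi$. (iii) If $C_{-1}=C_{+1}=A$ and $\phi$ has (finite) order $n$ in $\mathrm{Out}(A)$, let $a_0\in A$ be such that $\phi^n(a)=a_0aa_0^{-1}$ for all $a\in A$. Then $$Z(\Gamma)=\bigcup_{p\in\mathbb{Z}}t^{pn}\cdot\big(\mathrm{Fix}\,\phi\cap a_0^pZ(A)\big).$$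
   Context: Let $A$ be a group, $C_{-1},C_{+1}$ subgroups of $A$ and $\phi:C_{-1}\to C_{+1}$ an isomorphism. The HNN extension is $A*_\phi=\langle A,t\mid t^{-1}ct=\phi(c)\ \forall c\in C_{-1}\rangle$, and $A$ is identified with its (injective) image in it. $Z(A)$ is the centre of $A$; when $C_{-1}=C_{+1}=A$, the order of $\phi$ in $\mathrm{Out}(A)$ means the order of the class of the automorphism $\phi$ in $\mathrm{Out}(A)=\mathrm{Aut}(A)/\mathrm{Inn}(A)$. *)

(* Defs.v *)
From HB Require Import structures.
From mathcomp Require Import all_boot all_order all_algebra.
From mathcomp Require Import boolp classical_sets.

Set Implicit Arguments.
Unset Strict Implicit.
Unset Printing Implicit Defensive.

Import Algebra.
Local Open Scope classical_set_scope.
Local Open Scope group_scope.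

(* A group whose axioms hold up to an equivalence relation [eqv]. Its quotient
   by [eqv] is a group; the HNN extension (a quotient of words) and Out(A) are
   both obtained in this way. *)
Record setoidGroup := SetoidGroup {
  sg_sort :> choiceType;
  sg_mul : sg_sort -> sg_sort -> sg_sort;
  sg_one : sg_sort;
  sg_inv : sg_sort -> sg_sort;
  sg_eqv : sg_sort -> sg_sort -> Prop;
  sg_refl : forall x, sg_eqv x x;
  sg_sym : forall x y, sg_eqv x y -> sg_eqv y x;
  sg_trans : forall x y z, sg_eqv x y -> sg_eqv y z -> sg_eqv x z;
  sg_mulP : forall x x' y y', sg_eqv x x' -> sg_eqv y y' ->
    sg_eqv (sg_mul x y) (sg_mul x' y');
  sg_mulA : forall x y z,
    sg_eqv (sg_mul x (sg_mul y z)) (sg_mul (sg_mul x y) z);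
  sg_mul1 : forall x, sg_eqv (sg_mul sg_one x) x;
  sg_mulr1 : forall x, sg_eqv (sg_mul x sg_one) x;
  sg_mulV : forall x, sg_eqv (sg_mul (sg_inv x) x) sg_one;
  sg_mulrV : forall x, sg_eqv (sg_mul x (sg_inv x)) sg_one
}.

Section SetoidQuotient.
Variable G : setoidGroup.

Definition sg_rel : rel G := fun x y => `[< sg_eqv x y >].

Lemma sg_rel_refl : reflexive sg_rel.
Proof. by move=> x; apply/asboolP/sg_refl. Qed.

Lemma sg_rel_sym : symmetric sg_rel.
Proof. by move=> x y; apply/asboolP/asboolP; apply: sg_sym. Qed.

Lemma sg_rel_trans : transitive sg_rel.
Proof.
by move=> y x z /asboolP xy /asboolP yz; apply/asboolP/(sg_trans xy yz).
Qed.

Canonical sg_equiv := EquivRel sg_rel sg_rel_refl sg_rel_sym sg_rel_trans.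

Definition sg_quot := {eq_quot sg_equiv}%qT.

HB.instance Definition _ := Choice.on sg_quot.

Definition sg_class (x : G) : sg_quot := (\pi_(sg_quot) x)%qT.

Definition sg_repr (x : sg_quot) : G := repr x.

Lemma sg_reprK x : sg_class (sg_repr x) = x.
Proof. exact: reprK. Qed.

Lemma sg_classP x y : sg_class x = sg_class y <-> sg_eqv x y.
Proof.
split; first by move/eqquotP/asboolP.
by move=> h; apply/eqquotP/asboolP.
Qed.

Lemma sg_classK x : sg_eqv (sg_repr (sg_class x)) x.
Proof. by apply/sg_classP; rewrite sg_reprK. Qed.

Definition sgq_mul (x y : sg_quot) : sg_quot :=
  sg_class (sg_mul (sg_repr x) (sg_repr y)).
Definition sgq_one : sg_quot := sg_class (@sg_one G).
Definition sgq_inv (x : sg_quot) : sg_quot := sg_class (sg_inv (sg_repr x)).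

Lemma sg_class_mul x y :
  sg_class (sg_mul x y) = sgq_mul (sg_class x) (sg_class y).
Proof. by apply/sg_classP/sg_sym/sg_mulP; apply: sg_classK. Qed.

Lemma sgq_mulA : associative sgq_mul.
Proof.
move=> x y z; rewrite -(sg_reprK x) -(sg_reprK y) -(sg_reprK z).
by rewrite -!sg_class_mul; apply/sg_classP/sg_mulA.
Qed.

Lemma sgq_mul1 : left_id sgq_one sgq_mul.
Proof.
move=> x; rewrite -(sg_reprK x) -sg_class_mul.
exact/sg_classP/sg_mul1.
Qed.

Lemma sgq_mulr1 : right_id sgq_one sgq_mul.
Proof.
move=> x; rewrite -(sg_reprK x) -sg_class_mul.
exact/sg_classP/sg_mulr1.
Qed.

Lemma sgq_mulV : left_inverse sgq_one sgq_inv sgq_mul.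
Proof.
move=> x; rewrite -{2}(sg_reprK x) -sg_class_mul.
exact/sg_classP/sg_mulV.
Qed.

Lemma sgq_mulrV : right_inverse sgq_one sgq_inv sgq_mul.
Proof.
move=> x; rewrite -{1}(sg_reprK x) -sg_class_mul.
exact/sg_classP/sg_mulrV.
Qed.

HB.instance Definition _ :=
  isGroup.Build sg_quot sgq_mulA sgq_mul1 sgq_mulr1 sgq_mulV sgq_mulrV.

End SetoidQuotient.

Definition expgz (G : groupType) (x : G) (p : int) : G :=
  match p with Posz n => x ^+ n | Negz n => x ^- n.+1 end.

Definition center (G : groupType) : set G := [set z | forall x, commute z x].
Arguments center : clear implicits.

Definition infinite_order (G : groupType) (x : G) : Prop :=
  forall n, (0 < n)%N -> x ^+ n <> 1.

Definition has_order (G : groupType) (x : G) (n : nat) : Prop :=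
  [/\ (0 < n)%N, x ^+ n = 1 & forall m, (0 < m < n)%N -> x ^+ m <> 1].

Section Automorphisms.
Variable A : groupType.

Record aut := Aut {
  aut_fun :> A -> A;
  autM : {morph aut_fun : x y / x * y};
  aut_bij : bijective aut_fun
}.

HB.instance Definition _ := gen_eqMixin aut.
HB.instance Definition _ := gen_choiceMixin aut.

Lemma aut_ext (f g : aut) : f =1 g -> f = g.
Proof.
case: f g => [f fM fb] [g gM gb] /= /funext fg.
by case: _ / fg in gM gb *; congr Aut; apply: Prop_irrelevance.
Qed.

Lemma aut_id_morph : {morph (@id A) : x y / x * y}.
Proof. by []. Qed.

Lemma aut_id_bij : bijective (@id A).
Proof. by exists id. Qed.

Definition aut_one := Aut aut_id_morph aut_id_bij.

Lemma aut_comp_morph (f g : aut) : {morph (f \o g) : x y / x * y}.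
Proof. by move=> x y /=; rewrite !autM. Qed.

Lemma aut_comp_bij (f g : aut) : bijective (f \o g).
Proof. exact: bij_comp (aut_bij f) (aut_bij g). Qed.

Definition aut_mul (f g : aut) := Aut (aut_comp_morph f g) (aut_comp_bij f g).

Lemma aut_inv_ex (f : aut) : exists g : aut, cancel f g /\ cancel g f.
Proof.
case: (aut_bij f) => g fK gK.
have gM : {morph g : x y / x * y}.
  by move=> x y; apply: (can_inj fK); rewrite autM !gK.
by exists (Aut gM (Bijective gK fK)).
Qed.

Definition aut_inv (f : aut) : aut := sval (cid (aut_inv_ex f)).

Lemma aut_mulA : associative aut_mul.
Proof. by move=> f g h; apply: aut_ext. Qed.
Lemma aut_mul1 : left_id aut_one aut_mul.
Proof. by move=> f; apply: aut_ext. Qed.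
Lemma aut_mulr1 : right_id aut_one aut_mul.
Proof. by move=> f; apply: aut_ext. Qed.
Lemma aut_mulV : left_inverse aut_one aut_inv aut_mul.
Proof.
move=> f; apply: aut_ext => x /=; rewrite /aut_inv.
by case: cid => g [/= fK _]; apply: fK.
Qed.
Lemma aut_mulrV : right_inverse aut_one aut_inv aut_mul.
Proof.
move=> f; apply: aut_ext => x /=; rewrite /aut_inv.
by case: cid => g [/= _ gK]; apply: gK.
Qed.

HB.instance Definition _ :=
  isGroup.Build aut aut_mulA aut_mul1 aut_mulr1 aut_mulV aut_mulrV.

Lemma autE (f g : aut) x : (f * g) x = f (g x).
Proof. by []. Qed.

Lemma autKV (f : aut) x : f (f^-1 x) = x.
Proof. by have /(congr1 (fun g : aut => g x)) := mulgV f. Qed.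

Definition Inn : set aut := [set f | exists a, forall x, f x = a * x * a^-1].

Lemma Inn1 : Inn 1.
Proof. by exists 1 => x; rewrite invg1 mulg1 mul1g. Qed.

Lemma InnM f g : Inn f -> Inn g -> Inn (f * g).
Proof.
by move=> [a fa] [b gb]; exists (a * b) => x; rewrite autE fa gb invgM !mulgA.
Qed.

Lemma InnV f : Inn f -> Inn f^-1.
Proof.
move=> [a fa]; exists a^-1 => x; apply: (bij_inj (aut_bij f)).
by rewrite autKV fa invgK !mulgA mulgV mul1g -mulgA mulgV mulg1.
Qed.

Lemma InnJ f g : Inn f -> Inn (g^-1 * f * g).
Proof.
move=> [a fa]; exists (g^-1 a) => x; apply: (bij_inj (aut_bij g)).
rewrite !autE autKV fa; apply: (@mulIg _ a).
by rewrite -mulgA mulVg mulg1 -[X in _ = _ * X](autKV g) -!autM -mulgA mulVg mulg1 autM autKV.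
Qed.

Definition out_eqv (f g : aut) : Prop := Inn (f^-1 * g).

Lemma out_eqv_refl f : out_eqv f f.
Proof. by rewrite /out_eqv mulVg; apply: Inn1. Qed.

Lemma out_eqv_sym f g : out_eqv f g -> out_eqv g f.
Proof. by move/InnV; rewrite invgM invgK. Qed.

Lemma out_eqv_trans f g h : out_eqv f g -> out_eqv g h -> out_eqv f h.
Proof. by move=> fg /(InnM fg); rewrite -mulgA mulVKg. Qed.

Lemma out_eqv_mul f f' g g' :
  out_eqv f f' -> out_eqv g g' -> out_eqv (f * g) (f' * g').
Proof.
move=> /(InnJ g) ff' /(InnM ff').
by rewrite /out_eqv invgM -!mulgA mulVKg.
Qed.

Lemma out_eqv_eq f g : f = g -> out_eqv f g.
Proof. by move=> ->; apply: out_eqv_refl. Qed.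

Definition out_setoid : setoidGroup :=
  @SetoidGroup aut aut_mul aut_one aut_inv out_eqv
    out_eqv_refl out_eqv_sym out_eqv_trans out_eqv_mul
    (fun f g h => out_eqv_eq (aut_mulA f g h))
    (fun f => out_eqv_eq (aut_mul1 f)) (fun f => out_eqv_eq (aut_mulr1 f))
    (fun f => out_eqv_eq (aut_mulV f)) (fun f => out_eqv_eq (aut_mulrV f)).

Definition Out : groupType := sg_quot out_setoid.

Definition out_class (f : aut) : Out := sg_class (f : out_setoid).

End Automorphisms.

(* [phi] restricts to an isomorphism from [C] onto [D]; its values outside of
   [C] are irrelevant. *)
Record subgroup_iso (A : groupType) (C D : {pred A}) (phi : A -> A) : Prop :=
  SubgroupIso {
    iso_morph : {in C &, {morph phi : x y / x * y}};
    iso_inj : {in C &, injective phi};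
    iso_image : phi @` [set` C] = [set` D]
  }.

Section AutOfIso.
Variables (A : groupType) (C D : {pred A}) (phi : A -> A).
Hypothesis phi_iso : subgroup_iso C D phi.
Hypotheses (CT : C =i predT) (DT : D =i predT).

Lemma aut_of_iso_morph : {morph phi : x y / x * y}.
Proof. by move=> x y; apply: (iso_morph phi_iso); rewrite CT. Qed.

Lemma aut_of_iso_bij : bijective phi.
Proof.
have phi_surj y : exists x, phi x = y.
  have : [set` D] y by rewrite /= DT.
  by rewrite -(iso_image phi_iso) => -[x _ <-]; exists x.
exists (fun y => sval (cid (phi_surj y))) => [x|y].
- by case: cid => z /= /(iso_inj phi_iso); rewrite !CT => ->.
- by case: cid.
Qed.

Definition aut_of_iso : aut A := Aut aut_of_iso_morph aut_of_iso_bij.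

End AutOfIso.

Definition fix_iso (A : groupType) (C D : {pred A}) (phi : A -> A) : set A :=
  [set c | [/\ c \in C, c \in D & phi c = c]].

Section HNN.
Variables (A : groupType) (C : {pred A}) (phi : A -> A).

(* Words over the alphabet A + {t, t^-1}: [inl a] is the letter a, [inr true]
   is t and [inr false] is t^-1. *)
Definition hnn_word := seq (A + bool).

Inductive hnn_eqv : hnn_word -> hnn_word -> Prop :=
| hnn_refl u : hnn_eqv u u
| hnn_sym u v : hnn_eqv u v -> hnn_eqv v u
| hnn_trans u v w : hnn_eqv u v -> hnn_eqv v w -> hnn_eqv u w
| hnn_cat u u' v v' :
    hnn_eqv u u' -> hnn_eqv v v' -> hnn_eqv (u ++ v) (u' ++ v')
| hnn_base1 : hnn_eqv [:: inl 1] [::]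
| hnn_baseM a b : hnn_eqv [:: inl a; inl b] [:: inl (a * b)]
| hnn_stable e : hnn_eqv [:: inr e; inr (~~ e)] [::]
| hnn_conj c : c \in C ->
    hnn_eqv [:: inr false; inl c; inr true] [:: inl (phi c)].

Definition hnn_linv (l : A + bool) : A + bool :=
  match l with inl a => inl a^-1 | inr e => inr (~~ e) end.

Definition hnn_winv (w : hnn_word) : hnn_word := rev (map hnn_linv w).

Lemma hnn_linvK : involutive hnn_linv.
Proof. by case=> [a|e] /=; rewrite ?invgK ?negbK. Qed.

Lemma hnn_winvK : involutive hnn_winv.
Proof.
by move=> w; rewrite /hnn_winv map_rev revK -map_comp (eq_map hnn_linvK) map_id.
Qed.

Lemma hnn_letterV l : hnn_eqv [:: l; hnn_linv l] [::].
Proof.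
case: l => [a|e]; last exact: hnn_stable.
by apply: hnn_trans (hnn_baseM _ _) _; rewrite mulgV; apply: hnn_base1.
Qed.

Lemma hnn_wordV w : hnn_eqv (w ++ hnn_winv w) [::].
Proof.
elim: w => [|l w IHw]; first exact: hnn_refl.
have -> : (l :: w) ++ hnn_winv (l :: w) =
    [:: l] ++ (w ++ hnn_winv w) ++ [:: hnn_linv l].
  by rewrite /hnn_winv map_cons rev_cons -cats1 -catA.
apply: (hnn_trans _ (hnn_letterV l)).
exact: (hnn_cat (hnn_refl [:: l])
  (hnn_cat IHw (hnn_refl [:: hnn_linv l]))).
Qed.

Lemma hnn_wordVl w : hnn_eqv (hnn_winv w ++ w) [::].
Proof. by rewrite -{2}(hnn_winvK w); apply: hnn_wordV. Qed.

Lemma hnn_eqv_eq u v : u = v -> hnn_eqv u v.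
Proof. by move=> ->; apply: hnn_refl. Qed.

Definition hnn_setoid : setoidGroup :=
  @SetoidGroup hnn_word cat [::] hnn_winv hnn_eqv
    hnn_refl hnn_sym hnn_trans hnn_cat
    (fun u v w => hnn_eqv_eq (catA u v w))
    (fun u => hnn_refl u) (fun u => hnn_eqv_eq (cats0 u))
    hnn_wordVl hnn_wordV.

(* The group < A, t | t^-1 c t = phi c for all c in C >. *)
Definition hnn : groupType := sg_quot hnn_setoid.

Definition hnn_in (a : A) : hnn := sg_class ([:: inl a] : hnn_setoid).

Definition hnn_t : hnn := sg_class ([:: inr true] : hnn_setoid).

End HNN.

Arguments hnn_in {A} C phi a.

(* Main.v *)
Require Import Defs.
From HB Require Import structures.
From mathcomp Require Import all_boot all_order all_algebra.
From mathcomp Require Import boolp classical_sets.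
From mathcomp Require Import zify.

Set Implicit Arguments.
Unset Strict Implicit.
Unset Printing Implicit Defensive.

Import Algebra.
Local Open Scope classical_set_scope.
Local Open Scope group_scope.

(** Write Gamma for the HNN extension, C_+ for the domain and C_- for the image
    of phi. Everything rests on the normal form theorem: each element of Gamma
    is, in exactly one way, s_1 t^{e_1} ... s_k t^{e_k} a with a in A, each s_i
    in a fixed transversal of the left cosets of C_{e_i}, and no subword
    t^{-e} 1 t^e. It is obtained by letting Gamma act on normal forms by left
    multiplication ([act_eqv]) and reading the normal form of g off the image
    of the trivial one ([nf], [nfK]). In particular A embeds in Gamma, and an
    element of A commutes with t exactly when it is a fixed point of phi
    ([base_commute_t]); so the central elements of Gamma lying in A are those
    of Z(A) fixed by phi ([base_central]).

    Suppose that C_e is proper and z is central but not in A. For g in A, left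
    multiplication of z by g replaces its first coset representative s_1 by
    that of g s_1, while right multiplication only affects the tail; as both
    products agree, s_1 = 1 and C_{e_1} = A ([central_syl]). Hence e_1 = -e,
    and likewise the normal form of z^{-1} begins with t^{-e}. Then
    t^{-e} z is one syllable longer than z, whereas t^e z^{-1}, which is its
    inverse because z commutes with t, is one syllable shorter than z^{-1}.
    Length is invariant under inversion ([lenV]), a contradiction
    ([central_in_base]).

    If both subgroups are A then phi is an automorphism and every element is
    t^m a with m an integer. Commuting with t means that phi fixes a, and
    commuting with A means that phi^m is conjugation by a
    ([central_expgz_t_base]). If phi has infinite order in Out(A), this forces
    m = 0. If its order is n, then m = p n; since phi^{p n} is also conjugation
    by a_0^p, the two conjugators a and a_0^p differ by an element of Z(A). *)

(** * Associated subgroups and coset representatives *)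

Section NormalForms.
Variables (A : groupType) (Cm Cp : groupClosed A) (phi : A -> A).
Hypothesis phi_iso : subgroup_iso Cm Cp phi.

Local Notation Gamma := (hnn Cm phi).
Local Notation base := (hnn_in Cm phi).

(** The sign [true] stands for t and [false] for t^{-1}: with [psi] below, the
    defining relations become the symmetric pair c t^e = t^e psi_e(c) for c in
    C_e, so that both signs are treated at once. *)
Definition assoc (e : bool) : groupClosed A := if e then Cm else Cp.

Definition phi_inv (d : A) : A := xget 1 [set c | c \in Cm /\ phi c = d].

Definition psi (e : bool) : A -> A := if e then phi else phi_inv.

Lemma phi_in c : c \in Cm -> phi c \in Cp.
Proof.
move=> cC; have : (phi @` [set` Cm]) (phi c) by exists c.
by rewrite (iso_image phi_iso).
Qed.

Lemma phi_invP d : d \in Cp -> phi_inv d \in Cm /\ phi (phi_inv d) = d.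
Proof.
move=> dC; rewrite /phi_inv; case: xgetP => [c _ // | no_c].
have : [set` Cp] d by [].
by rewrite -(iso_image phi_iso) => -[c cC cd]; case: (no_c c).
Qed.

Lemma psi_in e c : c \in assoc e -> psi e c \in assoc (~~ e).
Proof. by case: e => /= [/phi_in | /phi_invP []]. Qed.

Lemma psiK e c : c \in assoc e -> psi (~~ e) (psi e c) = c.
Proof.
case: e => /= cC; last by have [] := phi_invP cC.
have [iC ic] := phi_invP (phi_in cC).
exact: (iso_inj phi_iso).
Qed.

Lemma psiM e c d :
  c \in assoc e -> d \in assoc e -> psi e (c * d) = psi e c * psi e d.
Proof.
case: e => /= cC dC; first exact: (iso_morph phi_iso).
have [ciC cK] := phi_invP cC; have [diC dK] := phi_invP dC.
have [cdiC cdK] : phi_inv (c * d) \in Cm /\ phi (phi_inv (c * d)) = c * d.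
  by apply: phi_invP; rewrite gpredM.
apply: (iso_inj phi_iso); rewrite ?gpredM //.
by rewrite (iso_morph phi_iso) // cdK cK dK.
Qed.

Lemma psi1 e : psi e 1 = 1.
Proof.
apply: (@mulgI _ (psi e 1)); rewrite -psiM ?gpred1 //.
by rewrite !mulg1.
Qed.

(** Representative of the coset x C_e. The trivial coset is represented by 1,
    which makes a cancellation t^{-e} s t^e visible as s = 1. *)
Definition rep (e : bool) (x : A) : A :=
  if x \in assoc e then 1 else choose [pred y | x^-1 * y \in assoc e] x.

Lemma rep_in e x : x^-1 * rep e x \in assoc e.
Proof.
rewrite /rep; case: ifPn => [xC | _]; first by rewrite mulg1 gpredV.
have xP : [pred y | x^-1 * y \in assoc e] x by rewrite /= mulVg gpred1.
exact: chooseP xP.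
Qed.

Lemma repM e x c : c \in assoc e -> rep e (x * c) = rep e x.
Proof.
move=> cC; rewrite /rep gpredMr //; case: ifP => // _.
have xP : [pred y | x^-1 * y \in assoc e] x by rewrite /= mulVg gpred1.
have xcP : [pred y | x^-1 * y \in assoc e] (x * c) by rewrite /= mulKg.
rewrite (choose_id xP xcP); apply: eq_choose => y /=.
by rewrite invgM -mulgA gpredMl // gpredV.
Qed.

Lemma rep_eq1 e x : (rep e x == 1) = (x \in assoc e).
Proof.
apply/eqP/idP => [r1 | xC]; last by rewrite /rep xC.
by have := rep_in e x; rewrite r1 mulg1 gpredV.
Qed.

Lemma rep1 e : rep e 1 = 1.
Proof. by apply/eqP; rewrite rep_eq1 gpred1. Qed.

Lemma rep_mul_rep e g x : rep e (g * rep e x) = rep e (g * x).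
Proof.
have -> : g * rep e x = g * x * (x^-1 * rep e x) by rewrite -mulgA mulVKg.
by rewrite repM ?rep_in.
Qed.

Lemma rep_rep e x : rep e (rep e x) = rep e x.
Proof. by have := rep_mul_rep e 1 x; rewrite !mul1g. Qed.

Lemma rep_div_in e x : (rep e x)^-1 * x \in assoc e.
Proof. by rewrite -gpredV invgM invgK rep_in. Qed.

(** * The action on normal forms *)

(** [Syl s e x] stands for s t^e x and [Tail a] for the final factor a. *)
Inductive nform := Tail of A | Syl of A & bool & nform.

(** With g s = r c, where r represents the coset and c lies in C_e, one has
    g s t^e = r t^e psi_e(c), and psi_e(c) is passed on to the rest. *)
Fixpoint act_base (g : A) (x : nform) : nform :=
  match x with
  | Tail a => Tail (g * a)
  | Syl s e y =>
      let r := rep e (g * s) in Syl r e (act_base (psi e (r^-1 * (g * s))) y)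
  end.

Definition starts (e : bool) (x : nform) : bool :=
  if x is Syl s e' _ then (s == 1) && (e' == e) else false.

Definition pop (x : nform) : nform := if x is Syl _ _ y then y else x.

Definition act_st (e : bool) (x : nform) : nform :=
  if starts (~~ e) x then pop x else Syl 1 e x.

Fixpoint reduced (x : nform) : bool :=
  if x is Syl s e y then [&& rep e s == s, ~~ starts (~~ e) y & reduced y]
  else true.

Lemma act_baseM g h x : act_base (g * h) x = act_base g (act_base h x).
Proof.
elim: x g h => [a | s e y IHy] g h /=; first by rewrite mulgA.
rewrite rep_mul_rep -mulgA; congr Syl; rewrite -IHy -psiM.
- by congr (act_base (psi _ _) _); rewrite !mulgA mulgK.
- by rewrite -(rep_mul_rep e g) rep_div_in.
- exact: rep_div_in.
Qed.

Lemma act_base1 x : reduced x -> act_base 1 x = x.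
Proof.
elim: x => [a _ | s e y IHy /= /and3P[/eqP rs _ /IHy y1]] /=.
  by rewrite mul1g.
by rewrite mul1g rs mulVg psi1 y1.
Qed.

(** Multiplication by an element of C_e preserves the trivial coset of C_e,
    hence whether a cancellation with t^{-e} is possible. *)
Lemma starts_act_base e c x :
  c \in assoc e -> reduced x -> starts e (act_base c x) = starts e x.
Proof.
case: x => [//|s e' y] /= cC /and3P[/eqP <- _ _].
have [->|_] := eqVneq e' e; last by rewrite !andbF.
by rewrite rep_mul_rep !rep_eq1 gpredMl.
Qed.

Lemma reduced_act_base g x : reduced x -> reduced (act_base g x).
Proof.
elim: x g => [//|s e y IHy] g /= /and3P[_ yst yred].
rewrite rep_rep eqxx IHy // starts_act_base ?yst //.
exact/psi_in/rep_div_in.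
Qed.

Lemma reduced_act_st e x : reduced x -> reduced (act_st e x).
Proof.
rewrite /act_st; case: ifPn => [_ | nst xred] /=; last by rewrite rep1 eqxx nst.
by case: x => [//|s e' y] /= /and3P[].
Qed.

(** When t^{-e} cancels the first syllable of x, reducedness of x prevents t^e
    from cancelling the next one, so that the removed syllable comes back. *)
Lemma act_stK e x : reduced x -> act_st e (act_st (~~ e) x) = x.
Proof.
rewrite {2}/act_st negbK; case: ifPn => [|nst _]; last first.
  by rewrite /act_st /= !eqxx.
case: x => [//|s e' y] /= /andP[/eqP -> /eqP ->] /and3P[_ nst _].
by rewrite /act_st (negbTE nst).
Qed.

Lemma act_base_st e c x : c \in assoc e -> reduced x ->
  act_base c (act_st e x) = act_st e (act_base (psi e c) x).
Proof.
move=> cC xred; rewrite /act_st starts_act_base ?psi_in //.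
case: ifPn => [|_] /=; last first.
  by rewrite mulg1 (eqP (_ : rep e c == 1)) ?rep_eq1 // invg1 mul1g.
case: x xred => [//|s e' y] /= _ /andP[/eqP -> /eqP ->].
rewrite mulg1 (eqP (_ : rep (~~ e) (psi e c) == 1)) ?rep_eq1 ?psi_in //.
by rewrite invg1 mul1g psiK.
Qed.

Definition act_letter (l : A + bool) : nform -> nform :=
  match l with inl a => act_base a | inr e => act_st e end.

Definition act (w : hnn_word A) (x : nform) : nform := foldr act_letter x w.

Lemma reduced_act w x : reduced x -> reduced (act w x).
Proof.
elim: w => [//|[a|e] w IHw] xred /=.
- exact/reduced_act_base/IHw.
- exact/reduced_act_st/IHw.
Qed.

(** The defining relations hold for the operators on reduced forms, so that
    these operators define an action of Gamma. *)
Lemma act_eqv u v :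
  hnn_eqv Cm phi u v -> forall x, reduced x -> act u x = act v x.
Proof.
elim=> {u v} //=.
- by move=> u v _ IH x xred; rewrite IH.
- by move=> u v w _ IHu _ IHv x xred; rewrite IHu ?IHv.
- move=> u u' v v' _ IHu _ IHv x xred.
  by rewrite /act !foldr_cat -!/(act _ _) IHv // IHu // reduced_act.
- exact: act_base1.
- by move=> a b x _; rewrite act_baseM.
- by move=> e x xred; rewrite act_stK.
- move=> c cC x xred; rewrite (act_base_st (e := true)) //.
  by rewrite (@act_stK false) // reduced_act_base.
Qed.

(** * The normal form of an element *)

Definition wclass (w : hnn_word A) : Gamma := sg_class (w : hnn_setoid Cm phi).
Definition stable (e : bool) : Gamma := wclass [:: inr e].

Lemma wclass_cat u v : wclass (u ++ v) = wclass u * wclass v.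
Proof. exact: (@sg_class_mul (hnn_setoid Cm phi)). Qed.

Lemma wclass_nil : wclass [::] = 1.
Proof. by []. Qed.

Lemma wclassV w : wclass (hnn_winv w) = (wclass w)^-1.
Proof.
apply/esym/mulg1_eq; rewrite -wclass_cat -wclass_nil.
exact/sg_classP/hnn_wordV.
Qed.

Lemma wclass_ex (g : Gamma) : exists w, g = wclass w.
Proof. by exists (sg_repr g); rewrite /wclass sg_reprK. Qed.

Lemma baseM a b : base (a * b) = base a * base b.
Proof. by rewrite -[RHS]wclass_cat; apply/esym/sg_classP/hnn_baseM. Qed.

Lemma base1 : base 1 = 1.
Proof. exact/sg_classP/hnn_base1. Qed.

Lemma baseV a : base a^-1 = (base a)^-1.
Proof. by apply/esym/mulg1_eq; rewrite -baseM mulgV base1. Qed.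

Lemma stableV e : (stable e)^-1 = stable (~~ e).
Proof. by rewrite -wclassV. Qed.

Lemma base_t c :
  c \in Cm -> base c * hnn_t Cm phi = hnn_t Cm phi * base (phi c).
Proof.
move=> cC; apply: (@mulgI _ (stable false)).
have -> : stable false * (hnn_t Cm phi * base (phi c)) = base (phi c).
  by rewrite -(stableV true) mulKg.
rewrite -(wclass_cat [:: inl c] [:: inr true]) -wclass_cat.
exact/sg_classP/hnn_conj.
Qed.

Lemma hnn_ind (P : Gamma -> Prop) :
  P 1 -> (forall a g, P g -> P (base a * g)) ->
  (forall e g, P g -> P (stable e * g)) -> forall g, P g.
Proof.
move=> P1 Pb Pst g; have [w ->] := wclass_ex g.
elim: w => [|l w IHw]; first by rewrite wclass_nil.
rewrite -cat1s wclass_cat.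
by case: l => [a|e]; [apply: Pb | apply: Pst].
Qed.

Definition nf (g : Gamma) : nform := act (sg_repr g) (Tail 1).

Lemma nf_wclass w : nf (wclass w) = act w (Tail 1).
Proof.
by apply: act_eqv => //; apply: (@sg_classK (hnn_setoid Cm phi)).
Qed.

Lemma nf_wclassM w g : nf (wclass w * g) = act w (nf g).
Proof.
have [v ->] := wclass_ex g.
by rewrite -wclass_cat !nf_wclass /act foldr_cat.
Qed.

Lemma nf_base a : nf (base a) = Tail a.
Proof. by rewrite [LHS]nf_wclass /= mulg1. Qed.

Lemma base_inj : injective base.
Proof. by move=> a b /(congr1 nf); rewrite !nf_base => -[]. Qed.

Fixpoint nf_word (x : nform) : hnn_word A :=
  match x with
  | Tail a => [:: inl a]
  | Syl s e y => [:: inl s, inr e & nf_word y]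
  end.

(** The operators do compute products in Gamma; applied to the trivial form,
    this shows that the normal form of g represents g. *)
Lemma wclass_act w x : wclass (nf_word (act w x)) = wclass (w ++ nf_word x).
Proof.
pose ev x := wclass (nf_word x).
have evS s e y : ev (Syl s e y) = base s * (stable e * ev y).
  rewrite -[RHS]/(wclass [:: inl s] * (wclass [:: inr e] * wclass _)).
  by rewrite -!wclass_cat.
have ev_base g y : ev (act_base g y) = base g * ev y.
  elim: y g => [a | s e y IHy] g; first exact: baseM.
  rewrite /= !evS IHy.
  (* Split g s as r c and use c t^e = t^e psi_e(c). *)
  set r := rep e _; set c := r^-1 * _.
  rewrite [RHS]mulgA -baseM ![in LHS]mulgA [RHS]mulgA; congr (_ * _).
  have cC : c \in assoc e by apply: rep_div_in.
  have -> : g * s = r * c by rewrite /c mulVKg.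
  rewrite baseM -!mulgA; congr (_ * _).
  case: (e) cC => /= cC; first by rewrite -base_t.
  have [iC iK] := phi_invP cC.
  apply: (@mulgI _ (stable true)); rewrite !mulgA -{2}iK.
  by rewrite -base_t // -(stableV true) mulgV mul1g mulgK.
elim: w => [//|l w IHw]; rewrite -cat1s -catA wclass_cat -IHw.
rewrite [act _ _]/=; move: (act w x) => y.
case: l => [a|e] /=; first exact: ev_base.
rewrite /act_st; case: ifPn => [|_]; last first.
  by rewrite -[LHS]/(ev (Syl 1 e y)) evS base1 mul1g.
case: y => [//|s e' z] /= /andP[/eqP -> /eqP ->].
by rewrite -[X in _ * X]/(ev (Syl 1 (~~ e) z)) evS base1 mul1g -stableV mulVKg.
Qed.

Lemma nfK g : wclass (nf_word (nf g)) = g.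
Proof.
rewrite wclass_act wclass_cat -[X in _ * X]/(base 1) base1 mulg1.
exact: sg_reprK.
Qed.

(** * Length *)

Fixpoint syllables (x : nform) : nat :=
  if x is Syl _ _ y then (syllables y).+1 else 0.

Definition is_stable (l : A + bool) : bool :=
  if l is inr _ then true else false.

Definition len (g : Gamma) : nat := syllables (nf g).

Lemma syllables_act_base a x : syllables (act_base a x) = syllables x.
Proof. by elim: x a => //= s e y IHy a; rewrite IHy. Qed.

Lemma len_wclass w : (len (wclass w) <= count is_stable w)%N.
Proof.
rewrite /len nf_wclass; elim: w => [//|[a|e] w IHw] /=.
  by rewrite syllables_act_base.
rewrite /act_st; case: ifP => _ //=.
apply: leq_trans (leq_trans IHw (leqnSn _)).
by case: (act w _) => //= *; apply: leqnSn.
Qed.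

Lemma count_nf_word x : count is_stable (nf_word x) = syllables x.
Proof. by elim: x => //= s e y ->. Qed.

(** The length of g is the least number of stable letters in a word for g
    ([len_wclass], attained by [nf_word]), and inverting a word preserves that
    number. *)
Lemma lenV g : len g^-1 = len g.
Proof.
suff le_lenV h : (len h^-1 <= len h)%N.
  by apply/eqP; rewrite eqn_leq le_lenV -{1}(invgK g) le_lenV.
rewrite -{1}(nfK h) -wclassV; apply: leq_trans (len_wclass _) _.
rewrite count_rev count_map /len -count_nf_word; apply/eq_leq/eq_count.
by case.
Qed.

Lemma len_stableM e g : len (stable e * g) =
  if starts (~~ e) (nf g) then (len g).-1 else (len g).+1.
Proof.
rewrite /len nf_wclassM /= /act_st; case: ifP => //.
by case: (nf g).
Qed.

(** * Central elements *)

Fixpoint rmul (x : nform) (g : A) : nform :=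
  match x with Tail a => Tail (a * g) | Syl s e y => Syl s e (rmul y g) end.

(** Right multiplication by A only changes the tail, as it commutes with the
    operators and does so for the trivial form. *)
Lemma nf_mul_base z g : nf (z * base g) = rmul (nf z) g.
Proof.
have [w ->] := wclass_ex z; rewrite nf_wclassM nf_base nf_wclass.
have rbase a x : act_base a (rmul x g) = rmul (act_base a x) g.
  by elim: x a => [b|s e y IHy] a /=; rewrite ?mulgA ?IHy.
rewrite -{1}(mul1g g) -[Tail (1 * g)]/(rmul (Tail 1) g).
elim: w => [//|[a|e] w IHw] /=; rewrite IHw //.
rewrite /act_st; case: (act w _) => //= s e' y.
by case: ifP.
Qed.

(** Comparing the first syllables of g z and z g for g in A shows that s
    represents all the cosets g s C_e, hence that there is only one coset. *)
Lemma central_syl z s e y : center Gamma z -> nf z = Syl s e y ->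
  s = 1 /\ assoc e =i predT.
Proof.
move=> zZ nfz.
have rep_s g : rep e (g * s) = s.
  have /(congr1 nf) := zZ (base g); rewrite nf_mul_base nf_wclassM nfz /=.
  by case.
have s1 : s = 1 by rewrite -(rep_s s^-1) mulVg rep1.
split=> // g; have := rep_eq1 e g.
by rewrite -{1}[g]mulg1 -s1 rep_s s1 eqxx => <-.
Qed.

Lemma centerV (G : groupType) (z : G) : center G z -> center G z^-1.
Proof. by move=> zZ x; apply/commute_sym/commuteV/commute_sym/zZ. Qed.

(** Otherwise the normal forms of z and of z^{-1} would both begin with t^{-e}.
    Then t^{-e} z would be longer than z and its inverse t^e z^{-1} shorter
    than z^{-1}, although length is invariant under inversion. *)
Lemma central_in_base e z :
  ~ (assoc e =i predT) -> center Gamma z -> exists a, z = base a.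
Proof.
move=> nC zZ; case nfz : (nf z) => [a | s e1 y].
  by exists a; rewrite -[LHS]nfK nfz.
have [s1 C1] := central_syl zZ nfz; subst s.
case nfz' : (nf z^-1) => [b | s e2 y'].
  exists b^-1; rewrite baseV; apply: invg_inj; rewrite invgK.
  by rewrite -[LHS]nfK nfz'.
have [s1 C2] := central_syl (centerV zZ) nfz'; subst s.
have e1E : e1 = ~~ e by apply/eqP; move: C1 nC; case: (e1) (e) => [] [].
have e2E : e2 = ~~ e by apply/eqP; move: C2 nC; case: (e2) (e) => [] [].
subst e1 e2.
have : len (stable (~~ e) * z) = len (stable e * z^-1).
  have -> : stable e * z^-1 = (stable (~~ e) * z)^-1.
    by rewrite invgM stableV negbK; apply/commute_sym/(centerV zZ).
  by rewrite lenV.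
rewrite !len_stableM lenV nfz nfz' /= negbK !eqxx /=.
by case: (e) => /=; lia.
Qed.

Lemma center_gen z : (forall a, commute z (base a)) ->
  commute z (hnn_t Cm phi) -> center Gamma z.
Proof.
move=> zb zt; elim/hnn_ind => [|a g zg|e g zg].
- exact: commute1.
- exact: commuteM.
- apply: commuteM => //; case: e => //.
  by rewrite -(stableV true); apply: commuteV.
Qed.

(** The normal form of a t has first representative that of the coset a C_+,
    and the normal form of t a has first representative 1; when a lies in C_+,
    the tails are phi(a) and a. *)
Lemma base_commute_t a :
  commute (base a) (hnn_t Cm phi) <-> fix_iso Cm Cp phi a.
Proof.
split=> [|[aC _ fa]]; last by rewrite /commute base_t // fa.
move/(congr1 nf); rewrite !nf_wclassM nf_base.
have -> : nf (hnn_t Cm phi) = Syl 1 true (Tail 1) by rewrite [LHS]nf_wclass.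
rewrite /= /act_st /= !mulg1 => -[r1].
rewrite r1 invg1 mul1g => fa.
have aC : a \in Cm by rewrite -[Cm]/(assoc true) -rep_eq1 r1.
by split=> //; rewrite -fa phi_in.
Qed.

Lemma base_central a :
  center Gamma (base a) <-> (center A `&` fix_iso Cm Cp phi) a.
Proof.
split=> [aZ | [aZ /base_commute_t at_]].
  split; last exact/base_commute_t/aZ.
  by move=> b; apply: base_inj; rewrite !baseM; apply: aZ.
by apply: center_gen => // b; rewrite /commute -!baseM aZ.
Qed.

Lemma center_eq_base : (forall z, center Gamma z -> exists a, z = base a) ->
  center Gamma = base @` (center A `&` fix_iso Cm Cp phi).
Proof.
move=> sub; apply/seteqP; split=> [z zZ | _ [a aZF <-]].
  have [a za] := sub z zZ; exists a => //.
  by apply/base_central; rewrite -za.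
exact/base_central.
Qed.

End NormalForms.

(** * Integer powers *)

Section IntegerPowers.
Variable G : groupType.
Implicit Types (x y : G) (m p : int) (n : nat).

Lemma expgz1D x m : expgz x (1 + m)%R = x * expgz x m.
Proof.
case: m => [n|[|n]] /=; first exact: expgS.
- by rewrite mulgV subnn.
- by rewrite subn1 [in RHS]expgSr invgM mulVKg.
Qed.

Lemma expgzB1 x m : expgz x (m - 1)%R = x^-1 * expgz x m.
Proof.
by apply: (@mulgI _ x); rewrite -expgz1D mulVKg GRing.addrC GRing.subrK.
Qed.

Lemma expgzM x p n : expgz x (p * n%:Z)%R = expgz (x ^+ n) p.
Proof.
have expN k : expgz x (- k%:Z)%R = (x ^+ k)^-1.
  by case: k => [|k]; rewrite ?invg1.
case: p => k; first by rewrite /= mulnC expgnA.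
by rewrite NegzE GRing.mulNr -PoszM expN mulnC expgnA.
Qed.

Lemma commute_expgz x y m : commute x y -> commute x (expgz y m).
Proof. by case: m => n xy; rewrite /=; [|apply: commuteV]; apply: commuteX. Qed.

End IntegerPowers.

(** * Order in the outer automorphism group *)

Section OuterOrder.
Variable A : groupType.
Implicit Type f : aut A.

Lemma aut_expE f n x : (f ^+ n) x = iter n f x.
Proof. by elim: n x => [//|n IHn] x; rewrite expgS autE IHn. Qed.

Lemma out_classX f n : out_class f ^+ n = out_class (f ^+ n).
Proof.
elim: n => [//|n IHn]; rewrite !expgS IHn.
by apply/esym; apply: (@sg_class_mul (out_setoid A)).
Qed.

Lemma out_class_eq1 f : out_class f = 1 <-> Inn f.
Proof.
split=> [/esym/(@sg_classP (out_setoid A)) | fI].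
  by rewrite /= /out_eqv invg1 mul1g.
apply/esym/(@sg_classP (out_setoid A)).
by rewrite /= /out_eqv invg1 mul1g.
Qed.

Lemma Inn_expgz f m : Inn (expgz f m) -> out_class f ^+ `|m| = 1.
Proof.
rewrite out_classX; case: m => n /= fI; apply/out_class_eq1 => //.
by rewrite -[f ^+ _]invgK; apply: InnV.
Qed.

Lemma expgz_conj f a p : (forall x, f x = a * x * a^-1) ->
  forall x, expgz f p x = expgz a p * x * (expgz a p)^-1.
Proof.
move=> fa.
have fXa n x : (f ^+ n) x = a ^+ n * x * (a ^+ n)^-1.
  elim: n x => [|n IHn] x; first by rewrite /= mul1g invg1 mulg1.
  by rewrite !expgS autE IHn fa invgM !mulgA.
case: p => n x /=; first exact: fXa.
apply: (bij_inj (aut_bij (f ^+ n.+1))); rewrite autKV fXa invgK !mulgA.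
by rewrite mulgV mul1g mulgK.
Qed.

End OuterOrder.

Lemma has_order_dvdn (G : groupType) (x : G) n m :
  has_order x n -> x ^+ m = 1 -> (n %| m)%N.
Proof.
move=> [n_gt0 xn xmin] xm; apply/negPn/negP; rewrite /dvdn -lt0n => r_gt0.
apply: (xmin (m %% n)%N); first by rewrite r_gt0 ltn_pmod.
by move: xm; rewrite {1}(divn_eq m n) expgnDr mulnC expgnA xn expg1n mul1g.
Qed.

(** * The case where both associated subgroups are the whole base group *)

Section FullAssociatedSubgroups.
Variables (A : groupType) (Cm Cp : groupClosed A) (phi : A -> A).
Hypothesis phi_iso : subgroup_iso Cm Cp phi.
Hypotheses (CmT : Cm =i predT) (CpT : Cp =i predT).

Local Notation Gamma := (hnn Cm phi).
Local Notation base := (hnn_in Cm phi).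
Local Notation t := (hnn_t Cm phi).
Local Notation f := (aut_of_iso phi_iso CmT CpT).

(** Here Gamma is the semidirect product of A by the infinite cyclic group
    generated by t; this is the rule for moving elements of A across powers
    of t. *)
Lemma base_expgz_t m x : base x * expgz t m = expgz t m * base (expgz f m x).
Proof.
have pos n y : base y * t ^+ n = t ^+ n * base ((f ^+ n) y).
  elim: n y => [|n IHn] y; first by rewrite mul1g mulg1.
  by rewrite expgSr mulgA IHn expgS autE -!mulgA base_t ?CmT.
case: m => n /=; first exact: pos.
apply: (@mulgI _ (t ^+ n.+1)); rewrite mulVKg.
by apply: (@mulIg _ (t ^+ n.+1)); rewrite mulgA mulgVK pos autKV.
Qed.

Lemma expgz_t_base_ex g : exists m a, g = expgz t m * base a.
Proof.
elim/hnn_ind: g => [|b _ [m [a ->]]|e _ [m [a ->]]].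
- by exists 0%R, 1; rewrite base1 mulg1.
- exists m, (expgz f m b * a).
  by rewrite mulgA base_expgz_t -mulgA -baseM.
- rewrite mulgA; case: e.
    by exists (1 + m)%R, a; rewrite expgz1D.
  by exists (m - 1)%R, a; rewrite expgzB1 (stableV _ _ true).
Qed.

Lemma central_expgz_t_base m a :
  center Gamma (expgz t m * base a) <->
  fix_iso Cm Cp phi a /\ (forall x, expgz f m x = a * x * a^-1).
Proof.
have tT : commute t (expgz t m) by apply: commute_expgz.
split=> [zZ | [/(base_commute_t phi_iso) a_t fa]]; last first.
  apply: center_gen => [x|]; last by apply/commute_sym/commuteM/commute_sym.
  rewrite /commute [RHS]mulgA base_expgz_t -!mulgA -!baseM fa.
  by rewrite mulgVK.
split=> [|x].
  apply/(base_commute_t phi_iso)/(@mulgI _ (expgz t m)).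
  by rewrite mulgA (zZ t) mulgA tT mulgA.
apply: (@mulIg _ a); rewrite mulgVK; apply: (base_inj phi_iso).
apply: (@mulgI _ (expgz t m)).
by rewrite !baseM !mulgA -base_expgz_t -[LHS]mulgA -(zZ (base x)).
Qed.

End FullAssociatedSubgroups.

(** * The centre of an HNN extension *)

Theorem mainTheorem6 (A : groupType) (Cm Cp : groupClosed A) (phi : A -> A)
    (phi_iso : subgroup_iso Cm Cp phi) :
  [/\ ~ (Cm =i predT) \/ ~ (Cp =i predT) ->
        center (hnn Cm phi) =
          hnn_in Cm phi @` (center A `&` fix_iso Cm Cp phi),
      forall (CmT : Cm =i predT) (CpT : Cp =i predT),
        infinite_order (out_class (aut_of_iso phi_iso CmT CpT)) ->
        center (hnn Cm phi) =
          hnn_in Cm phi @` (center A `&` fix_iso Cm Cp phi)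
    & forall (CmT : Cm =i predT) (CpT : Cp =i predT) (n : nat) (a0 : A),
        has_order (out_class (aut_of_iso phi_iso CmT CpT)) n ->
        (forall a, iter n phi a = a0 * a * a0^-1) ->
        center (hnn Cm phi) =
          \bigcup_(p in [set: int])
            [set expgz (hnn_t Cm phi) (p * n%:Z)%R * hnn_in Cm phi b
            | b in fix_iso Cm Cp phi `&`
                   [set expgz a0 p * z | z in center A]]].
Proof.
split.
- move=> proper; apply: (center_eq_base phi_iso) => z zZ.
  have [nC|nC] := proper.
    exact: (central_in_base phi_iso (e := true)).
  exact: (central_in_base phi_iso (e := false)).
- move=> CmT CpT oo; apply: (center_eq_base phi_iso) => z.
  have [m [a ->]] := expgz_t_base_ex phi_iso CmT CpT z.
  move=> /(central_expgz_t_base phi_iso CmT CpT)[_ fma].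
  have [-> | m_neq0] := eqVneq m 0%R; first by exists a; rewrite mul1g.
  have := Inn_expgz (ex_intro _ a fma).
  by move/oo; case; rewrite absz_gt0.
- move=> CmT CpT n a0 ord_n phin.
  pose f := aut_of_iso phi_iso CmT CpT.
  have fn p x : expgz f (p * n%:Z)%R x = expgz a0 p * x * (expgz a0 p)^-1.
    by rewrite expgzM; apply: expgz_conj => y; rewrite aut_expE phin.
  apply/seteqP; split=> [z | _ [p _ [b [bF [z zZ zb]] <-]]].
    have [m [a ->]] := expgz_t_base_ex phi_iso CmT CpT z.
    move=> /(central_expgz_t_base phi_iso CmT CpT)[aF fma].
    have : (n%:Z %| m)%Z.
      exact: (has_order_dvdn ord_n (Inn_expgz (ex_intro _ a fma))).
    case/dvdzP=> p mE; subst m; exists p => //; exists a => //.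
    split=> //; exists ((expgz a0 p)^-1 * a); last by rewrite mulVKg.
    move=> x; apply: (@mulgI _ (expgz a0 p)); apply: (@mulIg _ a^-1).
    rewrite !mulgA mulgV mul1g -fma fn.
    by rewrite mulgK.
  apply/(central_expgz_t_base phi_iso CmT CpT); split=> // x.
  by rewrite fn -zb invgM !mulgA -(mulgA _ z x) (zZ x) !mulgA (mulgK z).
Qed.
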